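(* For every field $\mathbb{K}$ and every input matrix $D\in\mathbb{K}^{m\times n}$, the elimination algorithm described in the context returns a U-match decomposition of $D$; that is, its outputs $\mathcal{R}^{-1}\in\mathbb{K}^{m\times m}$, $\mathcal{C}^{-1}\in\mathbb{K}^{n\times n}$, $M\in\mathbb{K}^{m\times n}$ satisfy: $\mathcal{R}^{-1}$ and $\mathcal{C}^{-1}$ are upper unitriangular, $M$ is a matching matrix, and $\mathcal{R}^{-1}D=M\mathcal{C}^{-1}$ (equivalently $\mathcal{R}M=D\mathcal{C}$), where $D$ is the original input.
   Context: A (generalized) matching matrix has at most one nonzero entry in each row and each column. Upper unitriangular means upper triangular with ones on the diagonal. A U-match decomposition of $D\in\mathbb{K}^{m\times n}$ is a tuple $(\mathcal{R},M,D,\mathcal{C})$ with $\mathcal{R}M=D\mathcal{C}$, where $M\in\mathbb{K}^{m\times n}$ is a matching matrix and $\mathcal{R},\mathcal{C}$ are upper unitriangular. The leading entry of a nonzero row is its first (leftmost) nonzero entry. Algorithm. Let $B$ be a working copy of $D$. Initialize $L\gets I^{m\times m}$, $P\gets I^{n\times n}$, $M\gets 0^{m\times n}$. (i) For $i=m,m-1,\dots,1$: while there exist $j\in\{i+1,\dots,m\}$ and $k\in\{1,\dots,n\}$ such that $\mathrm{row}_i(B)$ and $\mathrm{row}_j(B)$ both have their leading nonzero entry in column $k$, set $\mathrm{row}_i(L)\gets\mathrm{row}_i(L)-\frac{B[i,k]}{B[j,k]}\mathrm{row}_j(L)$ and $\mathrm{row}_i(B)\gets\mathrm{row}_i(B)-\frac{B[i,k]}{B[j,k]}\mathrm{row}_j(B)$,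 both using the same coefficient $B[i,k]/B[j,k]$ evaluated before the update. (ii) For $i=1,\dots,m$: if $B[i,k]$ is the leading entry of $\mathrm{row}_i(B)$ for some $k$, set $\mathrm{row}_k(P)\gets\frac{1}{B[i,k]}\mathrm{row}_i(B)$ and $M[i,k]\gets B[i,k]$. Output $\mathcal{R}^{-1}=L$, $\mathcal{C}^{-1}=P$, and $M$. *)

(* Defs.v *)
From mathcomp Require Import all_boot all_algebra.
From Stdlib Require Import Relation_Operators.

Set Implicit Arguments.
Unset Strict Implicit.
Unset Printing Implicit Defensive.

Import GRing.Theory.
Local Open Scope ring_scope.

Section UMatch.

Variable K : fieldType.

(* [is_trig_mx] is the library's lower triangularity, hence the transpose. *)
Definition upper_unitriangular n (A : 'M[K]_n) : Prop :=
  is_trig_mx A^T /\ forall i, A i i = 1.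

Definition matching_matrix m n (M : 'M[K]_(m, n)) : Prop :=
  (forall i k1 k2, M i k1 != 0 -> M i k2 != 0 -> k1 = k2) /\
  (forall k i1 i2, M i1 k != 0 -> M i2 k != 0 -> i1 = i2).

Definition Umatch m n (R : 'M[K]_m) (M D : 'M[K]_(m, n)) (C : 'M[K]_n) : Prop :=
  [/\ R *m M = D *m C,
      matching_matrix M,
      upper_unitriangular R
    & upper_unitriangular C].

Definition leading m n (B : 'M[K]_(m, n)) (i : 'I_m) (k : 'I_n) : bool :=
  (B i k != 0) && [forall k' : 'I_n, (k' < k)%N ==> (B i k' == 0)].

Definition clash m n (B : 'M[K]_(m, n)) (i j : 'I_m) (k : 'I_n) : bool :=
  [&& (i < j)%N, leading B i k & leading B j k].

Definition sub_row m n (i j : 'I_m) (c : K) (A : 'M[K]_(m, n)) : 'M[K]_(m, n) :=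
  \matrix_(r, s) if r == i then A i s - c * A j s else A r s.

Definition set_row m n (i : 'I_m) (v : 'rV[K]_n) (A : 'M[K]_(m, n)) :
    'M[K]_(m, n) :=
  \matrix_(r, s) if r == i then v 0 s else A r s.

Definition set_entry m n (i : 'I_m) (k : 'I_n) (x : K) (A : 'M[K]_(m, n)) :
    'M[K]_(m, n) :=
  \matrix_(r, s) if (r == i) && (s == k) then x else A r s.

(* A state of the first loop.  Rows are visited from the last to the first;
   [todo] is the number of rows not yet finished, so that (with indices
   starting from 0) the current row [i] is the one with [todo = i.+1], and the
   loop has ended when [todo = 0]. *)
Record config m n := Config {
  todo : nat;
  work : 'M[K]_(m, n);
  left_factor : 'M[K]_m
}.

(* One iteration of the inner while loop on row [i] (the choice of [j] and [k]
   is left open), or its exit, which passes to the previous row. *)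
Inductive step m n : config m n -> config m n -> Prop :=
| StepEliminate (i j : 'I_m) (k : 'I_n) (B : 'M[K]_(m, n)) (L : 'M[K]_m) :
    clash B i j k ->
    step (Config i.+1 B L)
         (Config i.+1 (sub_row i j (B i k / B j k) B)
                      (sub_row i j (B i k / B j k) L))
| StepNext (i : 'I_m) (B : 'M[K]_(m, n)) (L : 'M[K]_m) :
    (forall j k, ~~ clash B i j k) ->
    step (Config i.+1 B L) (Config i B L).

Definition init m n (D : 'M[K]_(m, n)) : config m n := Config m D 1%:M.

(* No infinite execution starts from [init D]. *)
Definition terminates m n (D : 'M[K]_(m, n)) : Prop :=
  Acc (fun s' s : config m n => step s s') (init D).

(* The pair is [(P, M)]; a row has at most one leading position, so [pick]
   involves no choice. *)
Definition extract_row m n (B : 'M[K]_(m, n)) (PM : 'M[K]_n * 'M[K]_(m, n))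
    (i : 'I_m) : 'M[K]_n * 'M[K]_(m, n) :=
  if [pick k | leading B i k] is Some k then
    (set_row k ((B i k)^-1 *: row i B) PM.1, set_entry i k (B i k) PM.2)
  else PM.

Definition extract m n (B : 'M[K]_(m, n)) : 'M[K]_n * 'M[K]_(m, n) :=
  foldl (extract_row B) (1%:M, 0) (enum 'I_m).

(* [(L, P, M)] is the result of some complete execution on the input [D]. *)
Definition returns m n (D : 'M[K]_(m, n))
    (L : 'M[K]_m) (P : 'M[K]_n) (M : 'M[K]_(m, n)) : Prop :=
  exists2 B : 'M[K]_(m, n),
    clos_refl_trans _ (@step m n) (init D) (Config 0 B L) & extract B = (P, M).

End UMatch.

(* Main.v *)
Require Import Defs.
From mathcomp Require Import all_boot all_algebra.
From Stdlib Require Import Relation_Operators.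

Set Implicit Arguments.
Unset Strict Implicit.
Unset Printing Implicit Defensive.

Import GRing.Theory.
Local Open Scope ring_scope.

(** Along an execution the working copy is [B = L D] with [L] upper
unitriangular, and the rows already visited have pairwise distinct leading
columns. Each elimination on a row pushes its leading position strictly to the
right, which gives termination. In the final [B] distinct nonzero rows lead in
distinct columns, so no row of [P] is overwritten: row [k] of [P] is either the
normalized row of [B] leading in column [k] or a row of the identity. Hence [P]
is upper unitriangular and [M P] restores [B] row by row. *)

(** * Upper unitriangular matrices and their inverses *)

Section UpperUnitriangular.

Variables (K : fieldType) (n : nat).
Implicit Types A : 'M[K]_n.

Lemma upper_unitriangularP A :
  upper_unitriangular A <->
  (forall i j : 'I_n, (j < i)%N -> A i j = 0) /\ (forall i, A i i = 1).
Proof.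
split=> -[A0 A1]; split=> //.
  by move=> i j ltji; move/is_trig_mxP: A0 => /(_ j i ltji); rewrite mxE.
by apply/is_trig_mxP => i j ltij; rewrite mxE A0.
Qed.

Lemma upper_unitriangular1 : upper_unitriangular (1%:M : 'M[K]_n).
Proof.
apply/upper_unitriangularP; split=> [i j ltji|i]; rewrite mxE ?eqxx //.
by rewrite -val_eqE gtn_eqF.
Qed.

Lemma upper_unitriangular_unitmx A : upper_unitriangular A -> A \in unitmx.
Proof.
case=> trigA A1; rewrite unitmxE -det_tr det_trig // big1 ?unitr1 // => i _.
by rewrite mxE.
Qed.

(** Back substitution: the identity [A *m invmx A = 1%:M] determines the rows of the inverse from
    the last one upwards. *)
Lemma upper_unitriangular_invmx A :
  upper_unitriangular A -> upper_unitriangular (invmx A).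
Proof.
move=> uA; have /upper_unitriangularP[A0 A1] := uA.
have AV : A *m invmx A = 1%:M by rewrite mulmxV ?upper_unitriangular_unitmx.
have AVE (r c : 'I_n) : (forall s : 'I_n, (r < s)%N -> invmx A s c = 0) ->
    invmx A r c = (r == c)%:R.
  move=> Vc0; have /matrixP/(_ r c) := AV; rewrite !mxE (bigD1 r) //=.
  rewrite A1 mul1r big1 ?addr0 // => s; rewrite -val_eqE /= neq_ltn.
  by case/orP=> [/A0->|/Vc0->]; rewrite ?mul0r ?mulr0.
(* Since [d] bounds [n - r], the induction runs from the last row upwards; at [d = 0] there is no
   such row. *)
have V0 d (r c : 'I_n) : (n - r <= d)%N -> (c < r)%N -> invmx A r c = 0.
  elim: d r c => [|d IHd] r c le_d ltcr.
    by move: le_d; rewrite leqn0 subn_eq0 leqNgt ltn_ord.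
  rewrite AVE => [|s ltrs]; first by rewrite -val_eqE gtn_eqF.
  apply: IHd; last exact: ltn_trans ltrs.
  by rewrite -ltnS; apply: leq_trans le_d; apply: ltn_sub2l.
apply/upper_unitriangularP; split=> [r c|r]; first exact: (V0 (n - r)%N).
by rewrite AVE ?eqxx // => s; apply: (V0 (n - s)%N).
Qed.

End UpperUnitriangular.

(** * Leading entries of rows *)

Section Leading.

Variables (K : fieldType) (m n : nat).
Implicit Types (B : 'M[K]_(m, n)) (i j : 'I_m) (k : 'I_n).

Lemma leadingP B i k :
  reflect (B i k != 0 /\ forall k' : 'I_n, (k' < k)%N -> B i k' = 0)
          (leading B i k).
Proof.
apply: (iffP andP) => -[Bik0 Bi0]; split=> //.
  by move=> k' ltk'k; apply/eqP; move/forallP/(_ k')/implyP: Bi0; apply.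
by apply/forallP=> k'; apply/implyP=> /Bi0->.
Qed.

Lemma leading_inj B i k1 k2 : leading B i k1 -> leading B i k2 -> k1 = k2.
Proof.
case/leadingP=> nz1 z1 /leadingP[nz2 z2]; apply: val_inj => /=.
case: (ltngtP k1 k2) => // [/z2 k1_0 | /z1 k2_0].
  by rewrite k1_0 eqxx in nz1.
by rewrite k2_0 eqxx in nz2.
Qed.

Lemma leading_exists B i k : B i k != 0 -> exists k', leading B i k'.
Proof.
move=> nzk; case: (@arg_minnP _ k (fun s => B i s != 0) val nzk) => k' nzk' min.
exists k'; apply/leadingP; split=> // k2 ltk2.
by apply/eqP; apply: contraTT ltk2 => /min; rewrite -leqNgt.
Qed.

Lemma eq_leading B B' i k :
  (forall s, B' i s = B i s) -> leading B' i k = leading B i k.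
Proof.
move=> eqB; rewrite /leading eqB; congr (_ && _).
by apply: eq_forallb => k'; rewrite eqB.
Qed.

(** Left of [k] both rows vanish, and at [k] the coefficient is chosen to cancel; this drives
    termination. *)
Lemma sub_row_eliminates B i j k :
  clash B i j k ->
  forall k' : 'I_n, (k' <= k)%N -> sub_row i j (B i k / B j k) B i k' = 0.
Proof.
case/and3P=> _ /leadingP[_ z1] /leadingP[nz2 z2] k'; rewrite mxE eqxx.
rewrite leq_eqVlt => /orP[/eqP/val_inj->|lt]; first by rewrite divfK // subrr.
by rewrite (z1 k') // (z2 k') // mulr0 subrr.
Qed.

End Leading.

(** * The first loop: termination, progress and invariant *)

Section Execution.

Variables (K : fieldType) (m n : nat).
Implicit Types (B D : 'M[K]_(m, n)) (L : 'M[K]_m) (i j : 'I_m) (k : 'I_n).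

(** A row operation is left multiplication by an elementary matrix, so it commutes with right
    multiplication by [D]. *)
Lemma mul_sub_row i j c L D :
  sub_row i j c L *m D = sub_row i j c (L *m D).
Proof.
apply/matrixP=> r s; rewrite !mxE; case: eqP => [->|neq_ri].
  rewrite mulr_sumr -sumrB; apply: eq_bigr => t _.
  by rewrite mxE eqxx mulrBl mulrA.
by apply: eq_bigr => t _; rewrite mxE; case: eqP.
Qed.

(** Row [j] of [L] is supported on columns from [j] on, all beyond [i], so row [i] changes only
    right of the diagonal. *)
Lemma upper_unitriangular_sub_row i j c L :
  (i < j)%N -> upper_unitriangular L -> upper_unitriangular (sub_row i j c L).
Proof.
move=> ltij /upper_unitriangularP[L0 L1]; apply/upper_unitriangularP.
split=> [r s|r]; rewrite mxE; case: eqP => [->|_] //; last 1 first.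
- by rewrite L1 (L0 j i) // mulr0 subr0.
- by move=> ltsi; rewrite (L0 i s) // (L0 j s) ?(ltn_trans ltsi) // mulr0 subr0.
- exact: L0.
Qed.

Lemma step_inv t B L s :
  step (Config t B L) s ->
  exists2 i : 'I_m, t = i.+1 &
    s = Config i B L \/
    exists j k, clash B i j k /\
      s = Config t (sub_row i j (B i k / B j k) B)
                   (sub_row i j (B i k / B j k) L).
Proof.
move Es0: (Config t B L) => s0 st.
case: s0 s / st Es0 => [i j k B0 L0 cl|i B0 L0 _] [-> -> ->]; exists i => //.
  by right; exists j, k.
by left.
Qed.

(** Lexicographic descent: first on the number of unfinished rows, then on the number of entries of
    the current row not yet known to vanish. *)
Lemma Acc_step (s : config K m n) : Acc (fun s' s => step s s') s.
Proof.
case: s => t; elim: t => [|t IHt] B L.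
  by constructor=> s /step_inv[].
(* The row of index [t] vanishes on its first [p] entries. *)
suff acc d p B' L' : (n - p <= d)%N ->
    (forall (i : 'I_m) (k : 'I_n), i = t :> nat -> (k < p)%N -> B' i k = 0) ->
    Acc (fun s' s => step s s') (Config t.+1 B' L').
  by apply: (acc n 0%N); rewrite ?subn0.
elim: d p B' L' => [|d IHd] p B' L' le_d z; constructor=> s;
  case/step_inv=> i [eq_ti] [->|[j [k [cl ->]]]]; try (by rewrite -eq_ti).
  (* Here [n <= p], so the current row is zero and has no leading entry. *)
  have /and3P[_ /leadingP[/eqP nz _] _] := cl; case: nz; apply: z => //.
  by apply: leq_trans (ltn_ord k) _; rewrite -subn_eq0 -leqn0.
have lepk : (p <= k)%N.
  have /and3P[_ /leadingP[nz _] _] := cl.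
  by rewrite leqNgt; apply: contra_neqN nz => ltkp; apply: z.
(* The elimination clears all columns up to [k], and [p <= k], so [p] grows to [k.+1]. *)
apply: (IHd k.+1) => [|i' k' eq_i't ltk'k].
  rewrite -ltnS; apply: leq_trans le_d; apply: ltn_sub2l => //.
  exact: leq_ltn_trans (ltn_ord k).
have -> : i' = i by apply: val_inj; rewrite /= eq_i't.
exact: sub_row_eliminates cl _ ltk'k.
Qed.

(** The bound by [m] makes the current row an index in ['I_m]; deciding whether it clashes selects
    the step. *)
Lemma step_progress (s : config K m n) :
  (0 < todo s <= m)%N -> exists s', step s s' /\ (todo s' <= m)%N.
Proof.
case: s => -[|t] B L //= lttm; pose i := Ordinal lttm.
have [/existsP[j /existsP[k cl]]|no] :=
    boolP [exists j, exists k, clash B i j k].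
  exists (Config t.+1 (sub_row i j (B i k / B j k) B)
                      (sub_row i j (B i k / B j k) L)).
  by split=> //; apply: (@StepEliminate _ _ _ i).
exists (Config t B L); split; last exact: ltnW.
apply: (@StepNext _ _ _ i) => j k; apply: contra no => cl.
by apply/existsP; exists j; apply/existsP; exists k.
Qed.

Lemma execution_exists (s : config K m n) :
  (todo s <= m)%N ->
  exists B L, clos_refl_trans _ (@step K m n) s (Config 0 B L).
Proof.
elim: (Acc_step s) => {}s _ IHs lesm.
case: (posnP (todo s)) => [t0|tgt0].
  by case: s t0 {IHs lesm} => t B L /= ->; exists B, L; apply: rt_refl.
have [|s' [st les'm]] := @step_progress s; first by rewrite tgt0.
have [B [L ex]] := IHs s' st les'm; exists B, L.
by apply: rt_trans ex; apply: rt_step.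
Qed.

(** As [clash] requires [i < j], the last clause concerns pairs of finished rows: they never share a
    leading column. *)
Definition step_invariant D (s : config K m n) : Prop :=
  [/\ left_factor s *m D = work s,
      upper_unitriangular (left_factor s)
    & forall i j k, (todo s <= i)%N -> ~~ clash (work s) i j k].

Lemma step_invariant_init D : step_invariant D (init D).
Proof.
split; rewrite /= ?mul1mx //; first exact: upper_unitriangular1.
by move=> i j k; rewrite leqNgt ltn_ord.
Qed.

Lemma step_invariant_step D s s' :
  step s s' -> step_invariant D s -> step_invariant D s'.
Proof.
case=> [i j k B L cl|i B L nocl] [/= LD uL nocl'].
  split; rewrite /= ?mul_sub_row ?LD //.
    by apply: upper_unitriangular_sub_row uL; case/and3P: cl.
  move=> i1 j1 k1 lti1; apply: contra (nocl' i1 j1 k1 lti1).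
  (* The elimination alters row [i] only, while a clash starting at a finished row involves only
     rows after [i]. *)
  have keep (r : 'I_m) : (i < r)%N ->
      leading (sub_row i j (B i k / B j k) B) r k1 = leading B r k1.
    by move=> ltir; apply: eq_leading => s1; rewrite mxE -val_eqE gtn_eqF.
  case/and3P=> lt1 ld1 ld2; rewrite /clash lt1 -(keep i1) // ld1.
  by rewrite -(keep j1) // (ltn_trans lti1).
split=> //= i1 j1 k1; rewrite leq_eqVlt => /orP[/eqP/val_inj<- //|].
exact: nocl'.
Qed.

Lemma step_invariant_execution D s s' :
  clos_refl_trans _ (@step K m n) s s' ->
  step_invariant D s -> step_invariant D s'.
Proof.
elim=> [x y /step_invariant_step st|//|x y z _ IH1 _ IH2 inv]; first exact: st.
exact/IH2/IH1.
Qed.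

End Execution.

(** * The second loop on a matrix without clashes *)

Section PivotRows.

Variables (K : fieldType) (m n : nat) (B : 'M[K]_(m, n)).
Hypothesis noclash : forall i j k, ~~ clash B i j k.

Lemma noclash_leading_inj i j k : leading B i k -> leading B j k -> i = j.
Proof.
move=> ldi ldj; apply: val_inj => /=.
case: (ltngtP i j) => // lt.
  by have := noclash i j k; rewrite /clash lt ldi ldj.
by have := noclash j i k; rewrite /clash lt ldi ldj.
Qed.

(** Generalized from [enum 'I_m] to any list of visited rows, for an induction that appends one row
    at the end. *)
Lemma extract_foldl (s : seq 'I_m) :
  let PM := foldl (extract_row B) (1%:M, 0) s in
  [/\ forall i k, PM.2 i k = if (i \in s) && leading B i k then B i k else 0,
      forall i k t, i \in s -> leading B i k ->
        PM.1 k t = (B i k)^-1 * B i t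
    & forall k t, (forall i, i \in s -> ~~ leading B i k) ->
        PM.1 k t = (k == t)%:R].
Proof.
elim/last_ind: s => [|s r] /=.
  by split=> // *; rewrite mxE.
rewrite -cats1 foldl_cat /=; set PM := foldl _ _ s => -[IHM IHP IHP1].
rewrite /extract_row; case: pickP => [k0 ld0|nold] /=; split.
- move=> i k; rewrite mxE IHM mem_cat inE.
  have [->|] /= := eqVneq i r; last by rewrite orbF.
  rewrite orbT /=; have [->|nek] := eqVneq k k0; first by rewrite ld0.
  have -> // : leading B r k = false.
    by apply: contra_neqF nek => ld; apply: leading_inj ld ld0.
  by rewrite andbF.
- move=> i k t; rewrite mem_cat inE mxE.
  have [-> _ ld|nek] := eqVneq k k0.
    (* A visited row leading in [k0] can only be [r], so the row just written is the right one. *)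
    by rewrite (noclash_leading_inj ld ld0) !mxE.
  case/orP=> [|/eqP->]; first exact: IHP.
  by move=> ld; rewrite (leading_inj ld ld0) eqxx in nek.
- move=> k t nold; rewrite mxE; case: eqP => [eqk|_].
    by have := nold r; rewrite eqk ld0 mem_cat inE eqxx orbT => /(_ isT).
  by apply: IHP1 => i si; apply: nold; rewrite mem_cat si.
- move=> i k; rewrite IHM mem_cat inE.
  by have [->|] := eqVneq i r; rewrite ?orbF // nold !andbF.
- move=> i k t; rewrite mem_cat inE => /orP[|/eqP->]; first exact: IHP.
  by rewrite nold.
- by move=> k t nold'; apply: IHP1 => i si; apply: nold'; rewrite mem_cat si.
Qed.

Variables (P : 'M[K]_n) (M : 'M[K]_(m, n)).
Hypothesis extractB : extract B = (P, M).

Lemma extract_matching i k : M i k = if leading B i k then B i k else 0.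
Proof.
by have [] := extract_foldl (enum 'I_m); rewrite -/(extract B) extractB => ->;
  rewrite mem_enum.
Qed.

Lemma extract_leading i k t : leading B i k -> P k t = (B i k)^-1 * B i t.
Proof.
have [_] := extract_foldl (enum 'I_m); rewrite -/(extract B) extractB => PE _.
by apply: PE; rewrite mem_enum.
Qed.

Lemma extract_not_leading k t :
  (forall i, ~~ leading B i k) -> P k t = (k == t)%:R.
Proof.
have [_ _] := extract_foldl (enum 'I_m); rewrite -/(extract B) extractB => PE ?.
exact: PE.
Qed.

Lemma matching_extract : matching_matrix M.
Proof.
have MnzP i k : M i k != 0 -> leading B i k.
  by rewrite extract_matching; case: ifP; rewrite ?eqxx.
split=> [i k1 k2 /MnzP ld1 /MnzP|k i1 i2 /MnzP ld1 /MnzP].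
  exact: leading_inj.
exact: noclash_leading_inj.
Qed.

Lemma upper_unitriangular_extract : upper_unitriangular P.
Proof.
apply/upper_unitriangularP.
have PE k : (exists2 i, leading B i k & forall t, P k t = (B i k)^-1 * B i t) \/
            (forall t, P k t = (k == t)%:R).
  have [/existsP[i ld]|no] := boolP [exists i, leading B i k].
    by left; exists i => // t; apply: extract_leading.
  right=> t; apply: extract_not_leading => i.
  by apply: contra no => ld; apply/existsP; exists i.
split=> [k t lttk|k]; have [[i /leadingP[nz z]]|] := PE k => ->.
- by rewrite (z t) ?mulr0.
- by rewrite -val_eqE gtn_eqF.
- by rewrite mulVf.
- by rewrite eqxx.
Qed.

(** In a nonzero row [i], the only nonzero entry of [M] is [B i k] at the leading column [k], which
    undoes the normalization of row [k] of [P]. *)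
Lemma mul_extract : M *m P = B.
Proof.
apply/matrixP=> i t; rewrite mxE.
have [/existsP[k ld]|no] := boolP [exists k, leading B i k].
  rewrite (bigD1 k) //= big1 => [|k' nek].
    rewrite extract_matching ld addr0 (extract_leading _ ld) mulVKf //.
    by case/leadingP: ld.
  rewrite extract_matching ifN ?mul0r //.
  by apply: contra_neqN nek => ld'; apply: leading_inj ld' ld.
rewrite big1 => [|k _].
  apply/esym/eqP; apply: contraNT no => /leading_exists[k ld].
  by apply/existsP; exists k.
rewrite extract_matching ifN ?mul0r //.
by apply: contra no => ld; apply/existsP; exists k.
Qed.

End PivotRows.

(** Since [returns] allows every choice of [j] and [k], correctness covers all complete executions;
    the existence clause keeps it from being vacuous. *)
Theorem mainTheorem8 (K : fieldType) (m n : nat) (D : 'M[K]_(m, n)) :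
  terminates D /\
  (exists (L : 'M[K]_m) (P : 'M[K]_n) (M : 'M[K]_(m, n)), returns D L P M) /\
  (forall (L : 'M[K]_m) (P : 'M[K]_n) (M : 'M[K]_(m, n)), returns D L P M ->
     [/\ upper_unitriangular L,
         upper_unitriangular P,
         matching_matrix M,
         L *m D = M *m P
       & Umatch (invmx L) M D (invmx P)]).
Proof.
split; first exact: Acc_step.
split=> [|L P M [B exec extB]].
  have [B [L exec]] := @execution_exists K m n (init D) (leqnn m).
  by case E: (extract B) => [P M]; exists L, P, M, B.
have [/= LD uL nocl'] :=
  step_invariant_execution exec (step_invariant_init D).
have nocl i j k : ~~ clash B i j k by exact: nocl'.
have uP := upper_unitriangular_extract nocl extB.
have LDMP : L *m D = M *m P by rewrite LD (mul_extract nocl extB).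
have matM := matching_extract nocl extB.
split=> //; split=> //; try exact: upper_unitriangular_invmx.
(* Write [D] as [invmx L *m (M *m P)], then cancel [P] on the right. *)
rewrite -[D](mulKmx (upper_unitriangular_unitmx uL)) LDMP -mulmxA.
by rewrite mulmxK ?upper_unitriangular_unitmx.
Qed.
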